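(* Let $X$ be a compact Hausdorff space, $N\ge1$, and $\phi_1,\dots,\phi_m$ real-valued continuous functions on $X$. For $d\ge1$ let $\mathcal C(X,d,\boldsymbol\phi)$ be the set of $d\times d$ matrix-valued Borel measures $\mu$ on $X$ with $\mu(\Delta)\ge0$ for all Borel $\Delta$, $\mu(X)=I_d$, and $\int_X\phi_r\,d\mu=0$ for $r=1,\dots,m$. Suppose the positive $N\times N$ matrix measure $\mu$ has the form $\mu=\sum_{k=1}^N\mu_kP_k$, where $P_1,\dots,P_N$ are pairwise orthogonal rank-one orthogonal projections on $\mathbb C^N$ with $\sum_{k=1}^NP_k=I_N$, and $\mu_1,\dots,\mu_N$ are scalar measures (not necessarily distinct and not necessarily with disjoint supports) each of which is an extreme point of $\mathcal C(X,1,\boldsymbol\phi)$. Then $\mu$ is an extreme point of $\mathcal C(X,N,\boldsymbol\phi)$. *)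

(* Defs.v *)
From HB Require Import structures.
From mathcomp Require Import all_boot all_order all_algebra.
From mathcomp Require Import all_classical all_reals all_analysis.
From mathcomp Require Import complex.

Set Implicit Arguments.
Unset Strict Implicit.
Unset Printing Implicit Defensive.

Import Order.TTheory GRing.Theory Num.Theory numFieldNormedType.Exports.
Local Open Scope classical_set_scope.
Local Open Scope ring_scope.
Local Open Scope complex_scope.

Section MatrixMeasures.
Variables (R : realType) (X : ptopologicalType).

Local Notation C := (R[i]).

Definition borelX := g_sigma_algebraType (@open X).

Definition Borel (A : set X) : Prop := (@measurable _ borelX) A.

Definition adjmx m n (A : 'M[C]_(m, n)) : 'M[C]_(n, m) :=
  (map_mx (@conjc R) A)^T.

Definition qform n (A : 'M[C]_n) (v : 'cV[C]_n) : C :=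
  (adjmx v *m A *m v) 0 0.

Definition psd_mx n (A : 'M[C]_n) : Prop :=
  forall v : 'cV[C]_n, complex.Im (qform A v) = 0 /\ 0 <= complex.Re (qform A v).

Definition matrix_measure d (mu : set X -> 'M[C]_d) : Prop :=
  forall F : nat -> set X,
    (forall k, Borel (F k)) -> trivIset setT F ->
    forall i j : 'I_d,
      ((fun n => complex.Re ((\sum_(k < n) mu (F k)) i j)) @ \oo -->
          complex.Re (mu (\bigcup_k F k) i j)) /\
      ((fun n => complex.Im ((\sum_(k < n) mu (F k)) i j)) @ \oo -->
          complex.Im (mu (\bigcup_k F k) i j)).

Definition pos_matrix_measure d (mu : set X -> 'M[C]_d) : Prop :=
  matrix_measure mu /\ forall A, Borel A -> psd_mx (mu A).

Definition qmeasure d (mu : set X -> 'M[C]_d) (v : 'cV[C]_d) :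
  set borelX -> \bar R := fun A => (complex.Re (qform (mu A) v))%:E.

(* Integral of a real continuous function f against a positive matrix
   measure mu: the matrix whose (i,j) entry is the integral of f against the
   complex measure mu_ij = e_i^* mu e_j, the latter being expressed through
   nonnegative scalar measures by polarization:
     mu_ij = 1/4 * sum_{k<4} conj(i^k) (e_i + i^k e_j)^* mu (e_i + i^k e_j). *)
Definition polvec d (i j : 'I_d) (k : nat) : 'cV[C]_d :=
  delta_mx i ord0 + ('i ^+ k) *: delta_mx j ord0.

Definition mx_integral d (mu : set X -> 'M[C]_d) (f : X -> R) : 'M[C]_d :=
  \matrix_(i, j)
    (4%:R^-1 * \sum_(k < 4)
       conjc ('i ^+ k) *
       (fine (\int[qmeasure mu (polvec i j k)]_x
                (f x)%:E))%:C).

Definition Cset d m (phi : 'I_m -> X -> R) (mu : set X -> 'M[C]_d) : Prop :=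
  [/\ pos_matrix_measure mu,
      mu setT = 1%:M &
      forall r : 'I_m, mx_integral mu (phi r) = 0].

Definition extreme_Cset d m (phi : 'I_m -> X -> R) (mu : set X -> 'M[C]_d)
  : Prop :=
  Cset phi mu /\
  forall (nu1 nu2 : set X -> 'M[C]_d) (t : R),
    Cset phi nu1 -> Cset phi nu2 -> 0 < t < 1 ->
    (forall A, Borel A -> mu A = t%:C *: nu1 A + (1 - t)%:C *: nu2 A) ->
    (forall A, Borel A -> nu1 A = mu A /\ nu2 A = mu A).

End MatrixMeasures.

Definition rank1_orth_proj (R : realType) N (P : 'M[R[i]]_N) : Prop :=
  [/\ adjmx P = P, P *m P = P & \rank P = 1%N].

(* Main.v *)
(* Let mu = t nu1 + (1 - t) nu2 and D = nu1 - mu. For x in the range of P_k,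
   the scalar measure x^* nu1 x / |x|^2 is admissible, so it equals mu_k by
   extremality: the diagonal blocks of D vanish, and positivity of nu1 then
   makes the off-diagonal block P_k D P_l vanish on mu_k-null sets. Like D it
   has zero mass and zero moments. An extreme scalar measure takes only values
   bounded away from 0 (besides 0), so absolute continuity upgrades to
   domination |P_k D P_l| <= K mu_k, and then mu_k +- eps P_k D P_l being
   admissible forces P_k D P_l = 0. *)

Require Import Defs.
From HB Require Import structures.
From mathcomp Require Import all_boot all_order all_algebra.
From mathcomp Require Import all_classical all_reals all_analysis.
From mathcomp Require Import measurable_realfun.
From mathcomp Require Import complex ring lra.

Set Implicit Arguments.
Unset Strict Implicit.
Unset Printing Implicit Defensive.

Import Order.TTheory GRing.Theory Num.Theory numFieldNormedType.Exports.
Local Open Scope classical_set_scope.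
Local Open Scope ring_scope.

Import HBNNSimple.

(** * Signed sums and integrals against scaled measures *)

Lemma sum_posneg (R : realDomainType) (I : Type) (s : seq I) (a b : I -> R) :
  \sum_(i <- s) a i * b i = \sum_(i <- s) Num.max (a i) 0 * b i -
                            \sum_(i <- s) Num.max (- a i) 0 * b i.
Proof.
rewrite -sumrB; apply: eq_bigr => i _; rewrite -mulrBl; congr (_ * _).
by case: (ltP (a i) 0) => h; case: (ltP (- a i) 0) => h'; lra.
Qed.

(** The nonnegative case on positive and negative parts; integrability rules out [oo - oo], so the
    factor distributes over their difference. *)
Lemma integral_mscale d (T : measurableType d) (R : realType)
    (M : {measure set T -> \bar R}) (D : set T) (k : {nonneg R}) (f : T -> \bar R) :
  measurable D -> M.-integrable D f ->
  (\int[mscale k M]_(x in D) f x = k%:num%:E * \int[M]_(x in D) f x)%E.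
Proof.
move=> mD If; have mf := measurable_int _ If.
rewrite [LHS]integralE [X in _ = (_ * X)%E]integralE.
rewrite !ge0_integral_mscale//; last 2 first.
- exact: measurable_funeneg.
- exact: measurable_funepos.
by rewrite [RHS]muleBr//; apply: fin_num_adde_defr; exact: integrable_pos_fin_num.
Qed.

(** * Finite Borel measures as real set functions, and their integrals *)

Section FiniteMeasure.
Variables (R : realType) (X : ptopologicalType).
Implicit Types g : set X -> R.

(** Real values allow signed combinations; only Borel sets are constrained, because matrix measures
    are arbitrary elsewhere. *)
Definition finite_measure_on_Borel g :=
  (forall A, Borel A -> 0 <= g A) /\
  forall F : nat -> set X, (forall k, Borel (F k)) -> trivIset setT F ->
    (fun n => \sum_(k < n) g (F k)) @ \oo --> g (\bigcup_k F k).

Local Notation fmeas := finite_measure_on_Borel.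

(** Additivity on the constant sequence of empty sets makes the multiples of [g set0] converge, so
    their constant increment is 0. *)
Lemma fmeas0 g : fmeas g -> g set0 = 0.
Proof.
move=> [_ /(_ (fun=> set0))].
have := @measurable0 _ (borelX X) => m0 /(_ (fun=> m0)).
rewrite bigcup0// => /(_ (@trivIset_set0 _ _ _)) h.
have h1 : (fun n => \sum_(k < n.+1) g set0) @ \oo --> g set0.
  by move: h; rewrite -(cvg_shiftS (fun n => \sum_(k < n) g set0)).
have : (fun n => \sum_(k < n.+1) g set0 - \sum_(k < n) g set0) @ \oo --> g set0 - g set0.
  exact: cvgB.
rewrite subrr; under eq_fun do rewrite big_ord_recr/= addrAC subrr add0r.
by move=> /cvg_lim; rewrite lim_cst// => ->.
Qed.

Section measure_of_fmeas.
Variables (g : set X -> R) (hg : fmeas g).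

(* Library measures must be nonnegative on all sets, measurable or not. *)
Definition borel_measure_fun (A : set (borelX X)) : \bar R :=
  if `[< Borel A >] then (g A)%:E else 0%E.

Let h0 : borel_measure_fun set0 = 0%E.
Proof. by rewrite /borel_measure_fun fmeas0// if_same. Qed.

Let hge A : (0 <= borel_measure_fun A)%E.
Proof.
by rewrite /borel_measure_fun; case: asboolP => // /(proj1 hg); rewrite lee_fin.
Qed.

Let hsa : semi_sigma_additive borel_measure_fun.
Proof.
move=> F mF tF mUF; rewrite /borel_measure_fun (asboolT mUF).
rewrite [X in X @ _ --> _](_ : _ = (fun n => (\sum_(k < n) g (F k))%:E)).
  by apply: cvg_EFin; [exact: nearW|exact: (proj2 hg)].
apply/funext => n; rewrite big_mkord -sumEFin; apply: eq_bigr => k _.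
by rewrite asboolT//; exact: mF.
Qed.

HB.instance Definition _ := isMeasure.Build _ _ _ borel_measure_fun h0 hge hsa.

Definition borel_measure : {measure set borelX X -> \bar R} := borel_measure_fun.

Lemma borel_measureE A : Borel A -> borel_measure A = (g A)%:E.
Proof. by move=> mA; rewrite /borel_measure/= /borel_measure_fun asboolT. Qed.

Lemma borel_measure_lty : (borel_measure setT < +oo)%E.
Proof. by rewrite (borel_measureE (@measurableT _ (borelX X))) ltry. Qed.

End measure_of_fmeas.

(* Needed because [qmeasure] is a bare set function, arbitrary off the Borel sets. *)
Lemma eq_integral_raw d (T : measurableType d) (m1 m2 : set T -> \bar R)
    (D : set T) (f : T -> \bar R) : (forall A, measurable A -> m1 A = m2 A) ->
  (\int[m1]_(x in D) f x = \int[m2]_(x in D) f x)%E.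
Proof.
move=> m12.
have E (h : {nnsfun T >-> R}) : sintegral m1 h = sintegral m2 h.
  by apply: eq_fsbigr => x _; rewrite m12.
by rewrite /integral; congr (ereal_sup _ - ereal_sup _)%E;
  apply/seteqP; split => _ [h hf <-]; exists h.
Qed.


Lemma continuous_borelX_measurable (f : X -> R) :
  continuous f -> measurable_fun setT (f : borelX X -> R).
Proof.
move=> /continuousP cf; apply: (measurability _ (RGenOpens.measurableE R)).
move=> _ [_ [a [b ->] <-]]; rewrite setTI.
by apply: sub_sigma_algebra; exact/cf/interval_open.
Qed.

Lemma fmeas_eq g h : (forall A, Borel A -> g A = h A) -> fmeas g -> fmeas h.
Proof.
move=> gh [g0 gs]; split=> [A mA|F mF tF]; first by rewrite -gh// g0.
rewrite -gh; last exact: (@bigcupT_measurable _ (borelX X)).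
by under eq_fun do under eq_bigr do rewrite -gh//; exact: gs.
Qed.

Lemma fmeasD g h : fmeas g -> fmeas h -> fmeas (fun A => g A + h A).
Proof.
move=> [g0 gs] [h0 hs]; split=> [A mA|F mF tF]; first by rewrite addr_ge0 ?g0 ?h0.
by under eq_fun do rewrite big_split/=; apply: cvgD; [exact: gs|exact: hs].
Qed.

Lemma fmeasZ c g : 0 <= c -> fmeas g -> fmeas (fun A => c * g A).
Proof.
move=> c0 [g0 gs]; split=> [A mA|F mF tF]; first by rewrite mulr_ge0 ?g0.
by under eq_fun do rewrite -mulr_sumr; apply: cvgZr; exact: gs.
Qed.

Lemma fmeas_cst0 : fmeas (fun=> 0).
Proof.
split=> // F _ _; under eq_fun do rewrite big1//.
exact: cvg_cst.
Qed.

Lemma fmeas_sum (I : Type) (s : seq I) (c : I -> R) (g : I -> set X -> R) :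
  (forall i, 0 <= c i) -> (forall i, fmeas (g i)) ->
  fmeas (fun A => \sum_(i <- s) c i * g i A).
Proof.
move=> c0 hg; elim: s => [|i s ih].
  by apply: fmeas_eq fmeas_cst0 => A _; rewrite big_nil.
apply: fmeas_eq (fmeasD (fmeasZ (c0 i) (hg i)) ih) => A _.
by rewrite big_cons.
Qed.

(** Taken against the bare set function, so that the scalar integrals inside [mx_integral] are
    instances by conversion. For a finite measure and continuous [f] on compact [X] the integral is
    finite and [fine] loses nothing. *)
Definition Int (f : X -> R) g : R :=
  fine (\int[fun A : set (borelX X) => (g A)%:E]_x (f x)%:E).

Lemma eq_Int f g h : (forall A, Borel A -> g A = h A) -> Int f g = Int f h.
Proof.
by move=> gh; congr fine; apply: eq_integral_raw => A mA; rewrite gh.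
Qed.

Section linearity.
Hypothesis cX : compact [set: X].
Variable f : X -> R.
Hypothesis cf : continuous f.

Let mf : measurable_fun setT (f : borelX X -> R).
Proof. exact: continuous_borelX_measurable. Qed.

Let intf (M : {measure set borelX X -> \bar R}) : (M setT < +oo)%E ->
  M.-integrable setT (EFin \o f).
Proof.
move=> MT; apply: measurable_bounded_integrable => //.
have /compact_bounded : compact (f @` setT).
  by apply: continuous_compact => //; exact: continuous_subspaceT.
move=> [M0 [M0r h]]; exists M0; split=> // y /h hy x _ /=; apply: hy.
by exists x.
Qed.

Let IntE g (hg : fmeas g) :
  (Int f g)%:E = (\int[borel_measure hg]_x (f x)%:E)%E.
Proof.
rewrite /Int (@eq_integral_raw _ _ _ (borel_measure hg)).
  rewrite fineK//; apply: integrable_fin_num => //; apply: intf.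
  exact: borel_measure_lty.
by move=> A mA; rewrite borel_measureE.
Qed.

Lemma IntD g h : fmeas g -> fmeas h ->
  Int f (fun A => g A + h A) = Int f g + Int f h.
Proof.
move=> hg hh; apply: EFin_inj; rewrite EFinD (IntE (fmeasD hg hh)) !IntE.
rewrite -integral_measure_add//.
- apply: eq_measure_integral => A mA _.
  by rewrite [RHS]measure_addE !borel_measureE.
- exact/intf/borel_measure_lty.
- exact/intf/borel_measure_lty.
Qed.

Lemma IntZ c g : 0 <= c -> fmeas g -> Int f (fun A => c * g A) = c * Int f g.
Proof.
move=> c0 hg; apply: EFin_inj; rewrite EFinM (IntE (fmeasZ c0 hg)) !IntE.
rewrite (@eq_measure_integral _ _ _ _ (mscale (NngNum c0) (borel_measure hg))).
  exact/integral_mscale/intf/borel_measure_lty.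
by move=> A mA _; rewrite [RHS](_ : _ = c%:E * borel_measure hg A)%E// !borel_measureE.
Qed.

Lemma Int_sum (I : Type) (s : seq I) (c : I -> R) (g : I -> set X -> R) :
  (forall i, 0 <= c i) -> (forall i, fmeas (g i)) ->
  Int f (fun A => \sum_(i <- s) c i * g i A) = \sum_(i <- s) c i * Int f (g i).
Proof.
move=> c0 hg; elim: s => [|i s ih].
  (* The empty sum is written [0 * 0] so that [IntZ] with factor 0 evaluates its integral. *)
  rewrite big_nil (@eq_Int _ _ (fun A => 0 * 0)); last first.
    by move=> A _; rewrite big_nil mulr0.
  by rewrite IntZ ?mul0r//; exact: fmeas_cst0.
rewrite big_cons -ih -IntZ// -IntD//.
- by apply: eq_Int => A _; rewrite big_cons.
- exact: fmeasZ.
- exact: fmeas_sum.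
Qed.

(** A signed combination need not be a measure, so [Int_sum] does not apply to it. Splitting the
    coefficients by sign turns the relation into an equality of two measures, whose integrals
    agree. *)
Lemma Int_lin0 (I : Type) (s : seq I) (a : I -> R) (g : I -> set X -> R) :
  (forall i, fmeas (g i)) ->
  (forall A, Borel A -> \sum_(i <- s) a i * g i A = 0) ->
  \sum_(i <- s) a i * Int f (g i) = 0.
Proof.
move=> hg h0.
have max0 (x : R) : 0 <= Num.max x 0 by rewrite le_max lexx orbT.
rewrite sum_posneg -!Int_sum//; apply/eqP; rewrite subr_eq0; apply/eqP.
by apply: eq_Int => A /h0; rewrite sum_posneg => /eqP; rewrite subr_eq0 => /eqP.
Qed.

End linearity.
End FiniteMeasure.

(** * Monotonicity, subadditivity and restriction of finite measures *)

Section Calculus.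
Variables (R : realType) (X : ptopologicalType).
Implicit Types g : set X -> R.
Local Notation fmeas := (@finite_measure_on_Borel R X).

Lemma BorelT : Borel [set: X].
Proof. exact: (@measurableT _ (borelX X)). Qed.

Lemma BorelI (A B : set X) : Borel A -> Borel B -> Borel (A `&` B).
Proof. exact: (@measurableI _ (borelX X)). Qed.

Lemma BorelD (A B : set X) : Borel A -> Borel B -> Borel (A `\` B).
Proof. exact: (@measurableD _ (borelX X)). Qed.

Lemma Borel_bigsetU (F : nat -> set X) n :
  (forall i, Borel (F i)) -> Borel (\big[setU/set0]_(i < n) F i).
Proof. by move=> mF; apply: (@bigsetU_measurable _ (borelX X)) => i _; exact: mF. Qed.

Lemma fmeas_le g A B : fmeas g -> Borel A -> Borel B -> A `<=` B -> g A <= g B.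
Proof.
move=> hg mA mB AB; rewrite -lee_fin -!(borel_measureE hg)//.
by apply: le_measure; rewrite ?inE.
Qed.

Lemma fmeas_sub_bigsetU g A (F : nat -> set X) n :
  fmeas g -> Borel A -> (forall i, Borel (F i)) ->
  g A <= g (A `\` \big[setU/set0]_(i < n) F i) + \sum_(i < n) g (F i).
Proof.
move=> hg mA mF; set U := \big[_/_]_(i < n) _.
have mU : Borel U by exact: Borel_bigsetU.
have mAU : Borel (A `\` U) by exact: BorelD.
rewrite -lee_fin EFinD -sumEFin -!(borel_measureE hg)//.
under eq_bigr do rewrite -(borel_measureE hg)//.
apply: (@le_trans _ _ (borel_measure hg (A `\` U) + borel_measure hg U)%E).
  apply: le_trans (measureU2 _ _ _) => //; apply: le_measure; rewrite ?inE//.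
    exact: (@measurableU _ (borelX X)).
  by move=> x Ax; have [Ux|nUx] := pselect (U x); [right|left].
by apply: leeD => //; apply: Boole_inequality => i _; exact: mF.
Qed.

Lemma fmeas_restr g B : Borel B -> fmeas g -> fmeas (fun A => g (B `&` A)).
Proof.
move=> mB [g0 gs]; split=> [A mA|F mF tF]; first by apply: g0; exact: BorelI.
rewrite setI_bigcupr; apply: gs => [k|]; first exact: BorelI.
exact: trivIset_setIl.
Qed.

End Calculus.

(** * Extreme points in the scalar case *)

Section ScalarExtreme.
Variables (R : realType) (X : ptopologicalType) (m : nat) (phi : 'I_m -> X -> R).
Hypothesis cX : compact [set: X].
Hypothesis cphi : forall r, continuous (phi r).
Implicit Types g : set X -> R.
Local Notation fmeas := (@finite_measure_on_Borel R X).

Definition scalar_Cset g :=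
  [/\ fmeas g, g setT = 1 & forall r, Int (phi r) g = 0].

(** Asking only for [g1] is enough: exchanging the summands and replacing [t] by [1 - t] gives
    [g2]. *)
Definition scalar_extreme g := scalar_Cset g /\
  forall g1 g2 t, scalar_Cset g1 -> scalar_Cset g2 -> 0 < t < 1 ->
    (forall A, Borel A -> g A = t * g1 A + (1 - t) * g2 A) ->
    forall A, Borel A -> g1 A = g A.

Lemma scalar_Cset_perturb g g1 g2 d :
  scalar_Cset g -> fmeas g1 -> fmeas g2 -> 0 <= d ->
  (forall A, Borel A -> d * (g2 A - g1 A) <= g A) ->
  g1 setT = g2 setT -> (forall r, Int (phi r) g1 = Int (phi r) g2) ->
  scalar_Cset (fun A => g A + d * (g1 A - g2 A)).
Proof.
move=> [hg gT gI] h1 h2 d0 dg T12 I12.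
have hp : fmeas (fun A => g A + d * (g1 A - g2 A)).
  split=> [A mA|F mF tF]; first by have := dg A mA; lra.
  under eq_fun do rewrite big_split/= -mulr_sumr sumrB.
  apply: cvgD; first exact: (proj2 hg).
  by apply: cvgZr; apply: cvgB; [exact: (proj2 h1)|exact: (proj2 h2)].
split=> [||r] //; first by rewrite /= gT T12 subrr mulr0 addr0.
(* With [d * g2] moved to the left, both sides are sums of positive measures, within reach of [IntD]
   and [IntZ]. *)
have E : forall A, Borel A ->
    g A + d * (g1 A - g2 A) + d * g2 A = g A + d * g1 A by move=> A _; ring.
have := eq_Int (phi r) E.
rewrite (IntD cX (@cphi r) hp (fmeasZ d0 h2)) (IntD cX (@cphi r) hg (fmeasZ d0 h1)).
by rewrite !IntZ// gI I12 add0r => /(canRL (addrK _)); rewrite subrr.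
Qed.

(** [g] is the midpoint of the admissible measures [g + d (g1 - g2)] and [g - d (g1 - g2)] for small
    [d], so extremality kills the difference. *)
Lemma scalar_extreme_bounded g g1 g2 K : scalar_extreme g ->
  fmeas g1 -> fmeas g2 -> 0 <= K ->
  (forall A, Borel A -> `|g1 A - g2 A| <= K * g A) ->
  g1 setT = g2 setT -> (forall r, Int (phi r) g1 = Int (phi r) g2) ->
  forall A, Borel A -> g1 A = g2 A.
Proof.
move=> [Cg eg] h1 h2 K0 hK T12 I12 A mA.
(* [K + 1] stays positive even when [K = 0]. *)
have d0 : 0 < (K + 1)^-1 by rewrite invr_gt0; lra.
have bound (s : R) B : Borel B -> `|s| <= K * g B -> (K + 1)^-1 * s <= g B.
  move=> mB hs; rewrite ler_pdivrMl; last lra.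
  have [[g0 _] _ _] := Cg; have := g0 B mB.
  have := ler_norm s; nra.
have C1 : scalar_Cset (fun A => g A + (K + 1)^-1 * (g1 A - g2 A)).
  apply: scalar_Cset_perturb => //; first exact: ltW.
  by move=> B mB; apply: bound => //; rewrite distrC hK.
have C2 : scalar_Cset (fun A => g A + (K + 1)^-1 * (g2 A - g1 A)).
  apply: scalar_Cset_perturb => //; first exact: ltW.
  by move=> B mB; apply: bound => //; rewrite hK.
have h12 : 0 < (2^-1 : R) < 1 by lra.
have avg B : Borel B -> g B = 2^-1 * (g B + (K + 1)^-1 * (g1 B - g2 B)) +
    (1 - 2^-1) * (g B + (K + 1)^-1 * (g2 B - g1 B)) by move=> _; field; lra.
have /eqP := eg _ _ _ C1 C2 h12 avg A mA.
by rewrite -subr_eq0 addrAC subrr add0r mulf_eq0 gt_eqF//= subr_eq0 => /eqP.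
Qed.

(** The signed measure is dominated by [g] times the sum of the absolute values of the [c i], and it
    has zero mass and moments; [scalar_extreme_bounded] applies to its parts with positive and
    negative coefficients. *)
Lemma scalar_extreme_comb g n (B : 'I_n -> set X) (c : 'I_n -> R) :
  scalar_extreme g -> (forall i, Borel (B i)) ->
  \sum_i c i * g (B i) = 0 ->
  (forall r, \sum_i c i * Int (phi r) (fun A => g (B i `&` A)) = 0) ->
  forall A, Borel A -> \sum_i c i * g (B i `&` A) = 0.
Proof.
move=> eg mB c0 cI A mA; have [[hg gT gI] _] := eg.
have max0 (x : R) : 0 <= Num.max x 0 by rewrite le_max lexx orbT.
have hr i : fmeas (fun A => g (B i `&` A)) by exact: fmeas_restr.
rewrite sum_posneg; apply/eqP; rewrite subr_eq0; apply/eqP; move: A mA.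
apply: (@scalar_extreme_bounded g _ _ (\sum_i `|c i|)) => //.
- exact: fmeas_sum.
- exact: fmeas_sum.
- exact: sumr_ge0.
- move=> A mA; rewrite -sum_posneg mulr_suml; apply: le_trans (ler_norm_sum _ _ _) _.
  apply: ler_sum => i _; rewrite normrM ler_wpM2l// ger0_norm; last first.
    by apply: (proj1 hg); exact: BorelI.
  by apply: fmeas_le => //; exact: BorelI.
- apply/eqP; rewrite -subr_eq0 -sum_posneg -[X in _ == X]c0; apply/eqP.
  by apply: eq_bigr => i _; rewrite setIT.
- move=> r; rewrite !Int_sum//; apply/eqP; rewrite -subr_eq0 -sum_posneg.
  exact/eqP/cI.
Qed.

(* The m+2 vectors of mass and moments live in dimension m+1. *)
Lemma scalar_extreme_dep g (B : 'I_m.+2 -> set X) :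
  scalar_extreme g -> (forall i, Borel (B i)) ->
  exists2 c : 'I_m.+2 -> R, (exists i, c i != 0) &
    forall A, Borel A -> \sum_i c i * g (B i `&` A) = 0.
Proof.
move=> eg mB.
pose M : 'M[R]_(m.+2, 1 + m) := row_mx (\col_i g (B i))
  (\matrix_(i, r) Int (phi r) (fun A => g (B i `&` A))).
have kM : kermx M != 0.
  rewrite kermx_eq0 /row_free; apply: contraTneq (rank_leq_col M) => ->.
  by rewrite -ltnNge.
have vM : nz_row (kermx M) *m M = 0 by apply/sub_kermxP; exact: nz_row_sub.
set v := nz_row _ in vM; have v0 : v != 0 by rewrite nz_row_eq0.
move: vM; rewrite mul_mx_row -[0 in RHS]row_mx0 => /eq_row_mx[v1 v2].
exists (v 0).
  by move/rV0Pn: v0.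
apply: scalar_extreme_comb => // [|r].
  have /matrixP/(_ 0 0) := v1; rewrite !mxE => h; rewrite -[RHS]h.
  by apply: eq_bigr => i _; rewrite mxE.
have /matrixP/(_ 0 r) := v2; rewrite !mxE => h; rewrite -[RHS]h.
by apply: eq_bigr => i _; rewrite mxE.
Qed.

(* Otherwise there are Borel sets b_0, b_1, ... whose positive masses decrease at
   least geometrically with ratio 1/2; in a linear relation between the
   measures g(b_i /\ .) the first nonzero coefficient is then seen on
   b_i minus the later b_j, which has positive mass. *)
Lemma scalar_extreme_gap g : scalar_extreme g ->
  exists2 e : R, 0 < e & forall A, Borel A -> g A = 0 \/ e <= g A.
Proof.
move=> eg; have [[hg _ _] _] := eg; apply: contrapT => /forall2NP hn.
have /choice[f fP] : forall e : R, exists A, 0 < e -> [/\ Borel A, 0 < g A & g A < e].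
  move=> e; have [e0|e0] := ltP 0 e; last by exists set0.
  have [//|/existsNP[A /not_implyP[mA /not_orP[gA0 /negP]]]] := hn e.
  rewrite -ltNge => gAe; exists A => _; split=> //.
  by rewrite lt_def (proj1 hg)// andbT; exact/eqP.
pose b n := iter n (fun A => f (g A / 2)) (f 1).
have bP n : Borel (b n) /\ 0 < g (b n).
  elim: n => [|n [mb gb]]; first by have [] := fP 1 ltr01.
  by have [] := fP (g (b n) / 2) ltac:(lra).
have bS n : g (b n.+1) <= g (b n) / 2.
  by have [] := fP (g (b n) / 2) ltac:(have := (bP n).2; lra); move=> _ _ /ltW.
(* By halving, each mass is at most the drop from its predecessor, and the drops telescope. The
   positive leftover [g (b (i + n))] later gives a strict inequality. *)
have bsum i n : \sum_(j < n) g (b (i + j).+1) <= g (b i) - g (b (i + n)%N).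
  elim: n => [|n ih]; first by rewrite big_ord0 addn0 subrr.
  by rewrite big_ord_recr/= addnS; have := bS (i + n)%N; lra.
have [c [i0 ci0] cP] := scalar_extreme_dep (B := fun i => b i) eg (fun i => (bP i).1).
pose i := [arg min_(i < i0 | c i != 0) (i : nat)].
have [ci imin] : c i != 0 /\ forall j, c j != 0 -> (i <= j)%N.
  by rewrite /i; case: arg_minnP.
(* [m.+2] successors of [b i] include every [b j] with [j > i] in the relation. *)
pose U := \big[setU/set0]_(j < m.+2) b (i + j).+1.
have mU : Borel U.
  by apply: (@Borel_bigsetU _ (fun j => b (i + j).+1)) => j; exact: (bP _).1.
have mA : Borel (b i `\` U) by apply: BorelD => //; exact: (bP _).1.
have := cP _ mA; rewrite (bigD1 i)//= big1 ?addr0 => [|j ji].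
  move/eqP; rewrite mulf_eq0 (negPf ci)/= setIDA setIid.
  have := fmeas_sub_bigsetU m.+2 hg (bP i).1 (fun j => (bP (i + j).+1).1).
  have := bsum i m.+2; have := (bP (i + m.+2)%N).2; rewrite -/U => h1 h2 h3 /eqP.
  lra.
have [->|cj] := eqVneq (c j) 0; first by rewrite mul0r.
rewrite (_ : _ `&` _ = set0) ?fmeas0 ?mulr0//.
have ij : (i < j)%N by rewrite ltn_neqAle imin// andbT eq_sym.
apply/seteqP; split=> // x [bjx [_]]; apply; rewrite /U.
have jE : (i + (j - i.+1)).+1 = j :> nat by rewrite -addSn subnKC.
rewrite -(bigcup_mkord m.+2 (fun j => b (i + j).+1)); exists (j - i.+1)%N.
  by rewrite /= (leq_ltn_trans (leq_subr _ _)).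
by rewrite jE.
Qed.

(** A nonzero [g A] is at least the gap [e], so the difference is at most the total mass of [g1] and
    [g2], over [e], times [g A]; on null sets it is 0. Thus [scalar_extreme_bounded] applies. *)
Theorem scalar_extreme_dominated g g1 g2 : scalar_extreme g ->
  fmeas g1 -> fmeas g2 -> g1 setT = g2 setT ->
  (forall r, Int (phi r) g1 = Int (phi r) g2) ->
  (forall A, Borel A -> g A = 0 -> g1 A = g2 A) ->
  forall A, Borel A -> g1 A = g2 A.
Proof.
move=> eg h1 h2 T12 I12 dom; have [e e0 he] := scalar_extreme_gap eg.
apply: (@scalar_extreme_bounded g _ _ ((g1 setT + g2 setT) / e)) => //.
  apply: divr_ge0; last exact: ltW.
  by apply: addr_ge0; [apply: (proj1 h1)|apply: (proj1 h2)]; exact: BorelT.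
move=> A mA.
have [gA0|geA] := he A mA; first by rewrite gA0 dom// subrr normr0 mulr0.
have l1 : g1 A <= g1 setT by apply: fmeas_le => //; exact: BorelT.
have l2 : g2 A <= g2 setT by apply: fmeas_le => //; exact: BorelT.
have p1 := proj1 h1 A mA; have p2 := proj1 h2 A mA.
apply: (@le_trans _ _ (g1 setT + g2 setT)).
  by rewrite ler_norml; lra.
rewrite mulrAC ler_pdivlMr// ler_wpM2l//; lra.
Qed.

End ScalarExtreme.

(** * Real and imaginary parts *)

Section ReIm.
Local Open Scope complex_scope.
Variable R : realType.
Implicit Types (z w : R[i]) (c : R).
Local Notation Re := (@complex.Re R).
Local Notation Im := (@complex.Im R).

Lemma Re_add z w : Re (z + w) = Re z + Re w. Proof. by case: z w => ? ? []. Qed.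
Lemma Im_add z w : Im (z + w) = Im z + Im w. Proof. by case: z w => ? ? []. Qed.
Lemma Re_sum (I : Type) (s : seq I) (F : I -> R[i]) :
  Re (\sum_(i <- s) F i) = \sum_(i <- s) Re (F i).
Proof. by apply: (big_morph Re) => //; exact: Re_add. Qed.
Lemma Im_sum (I : Type) (s : seq I) (F : I -> R[i]) :
  Im (\sum_(i <- s) F i) = \sum_(i <- s) Im (F i).
Proof. by apply: (big_morph Im) => //; exact: Im_add. Qed.
Lemma Re_mul z w : Re (z * w) = Re z * Re w - Im z * Im w.
Proof. by case: z w => ? ? []. Qed.
Lemma Re_scale c z : Re (c%:C * z) = c * Re z.
Proof. by rewrite Re_mul/= mul0r subr0. Qed.
Lemma Im_scale c z : Im (c%:C * z) = c * Im z.
Proof. by case: z => a b /=; rewrite mul0r addr0. Qed.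
Lemma complex_of_Im0 z : Im z = 0 -> z = (Re z)%:C.
Proof. by case: z => a b /= ->. Qed.
End ReIm.

(** Here [- i] plays the conjugate of [i]. After multiplication by the weight, only the [b] term is
    constant in [k]; the other three run through nontrivial characters and cancel. *)
Lemma roots4_sum (F : comPzRingType) (i a b c d : F) : i * i = -1 ->
  \sum_(k < 4) (- i) ^+ k *
    (a + i ^+ k * b + (- i) ^+ k * c + (- i) ^+ k * i ^+ k * d) = 4%:R * b.
Proof.
move=> i2; rewrite !big_ord_recl big_ord0 /= /bump/=.
ring: i2.
Qed.

(** * Sesquilinear forms, polarization and positivity *)

Section SesquilinearForm.
Local Open Scope complex_scope.
Variable R : realType.
Local Notation C := R[i].
Local Notation Re := (@complex.Re R).
Local Notation Im := (@complex.Im R).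

Definition bform n (B : 'M[C]_n) (x y : 'cV[C]_n) : C :=
  (adjmx x *m B *m y) 0 0.

Lemma adjmxD m n (A B : 'M[C]_(m, n)) : adjmx (A + B) = adjmx A + adjmx B.
Proof. by rewrite /adjmx map_mxD linearD. Qed.

Lemma adjmxZ m n a (A : 'M[C]_(m, n)) : adjmx (a *: A) = conjc a *: adjmx A.
Proof. by rewrite /adjmx map_mxZ linearZ. Qed.

Lemma adjmxM m n p (A : 'M[C]_(m, n)) (B : 'M[C]_(n, p)) :
  adjmx (A *m B) = adjmx B *m adjmx A.
Proof. by rewrite /adjmx map_mxM trmx_mul. Qed.

Lemma adjmx_delta n (i : 'I_n) : adjmx (delta_mx i 0 : 'cV[C]_n) = delta_mx 0 i.
Proof. by rewrite /adjmx map_delta_mx trmx_delta. Qed.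

Variable n : nat.
Implicit Types (B : 'M[C]_n) (x y z : 'cV[C]_n) (a : C).

Lemma bformDl B x y z : bform B (x + y) z = bform B x z + bform B y z.
Proof. by rewrite /bform adjmxD !mulmxDl mxE. Qed.

Lemma bformDr B x y z : bform B x (y + z) = bform B x y + bform B x z.
Proof. by rewrite /bform mulmxDr mxE. Qed.

Lemma bformZl B a x y : bform B (a *: x) y = conjc a * bform B x y.
Proof. by rewrite /bform adjmxZ -!scalemxAl mxE. Qed.

Lemma bformZr B a x y : bform B x (a *: y) = a * bform B x y.
Proof. by rewrite /bform -scalemxAr mxE. Qed.

Lemma bform_suml B (I : Type) (s : seq I) (F : I -> 'cV[C]_n) y :
  bform B (\sum_(i <- s) F i) y = \sum_(i <- s) bform B (F i) y.
Proof.
apply: (big_morph (fun x => bform B x y)) => [x z|]; first exact: bformDl.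
by rewrite -(scale0r (0 : 'cV[C]_n)) bformZl conjc0 mul0r.
Qed.

Lemma bform_sumr B (I : Type) (s : seq I) (F : I -> 'cV[C]_n) x :
  bform B x (\sum_(i <- s) F i) = \sum_(i <- s) bform B x (F i).
Proof.
apply: (big_morph (bform B x)) => [y z|]; first exact: bformDr.
by rewrite -(scale0r (0 : 'cV[C]_n)) bformZr mul0r.
Qed.

Lemma bform_delta B i j : bform B (delta_mx i 0) (delta_mx j 0) = B i j.
Proof. by rewrite /bform adjmx_delta -rowE -colE !mxE. Qed.

Lemma bformB A B x y : bform (A - B) x y = bform A x y - bform B x y.
Proof. by rewrite /bform mulmxBr mulmxBl !mxE. Qed.

Lemma qformE B x :
  qform B x = \sum_i \sum_j conjc (x i 0) * x j 0 * B i j.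
Proof.
rewrite [qform B x](_ : _ = bform B x x)// [in LHS](matrix_sum_delta x).
under eq_bigr do rewrite big_ord1.
rewrite bform_suml; apply: eq_bigr => i _; rewrite bform_sumr.
by apply: eq_bigr => j _; rewrite bformZl bformZr bform_delta mulrA.
Qed.

Lemma qform_lin (I : Type) (s : seq I) (c : I -> C) (F : I -> 'M[C]_n) x :
  qform (\sum_(k <- s) c k *: F k) x = \sum_(k <- s) c k * qform (F k) x.
Proof.
rewrite /qform mulmx_sumr mulmx_suml summxE; apply: eq_bigr => k _.
by rewrite -scalemxAr -scalemxAl mxE.
Qed.

Lemma qform_comb a b (A B : 'M[C]_n) x :
  qform (a *: A + b *: B) x = a * qform A x + b * qform B x.
Proof. by rewrite /qform mulmxDr mulmxDl -!scalemxAr -!scalemxAl !mxE. Qed.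

Lemma qformD B x y :
  qform B (x + y) = qform B x + qform B y + (bform B x y + bform B y x).
Proof.
by rewrite /qform -!/(bform _ _ _) !bformDl !bformDr; ring.
Qed.

Lemma qform_polvec B i j k : qform B (polvec R i j k) =
  B i i + 'i ^+ k * B i j + conjc ('i ^+ k) * B j i
  + conjc ('i ^+ k) * 'i ^+ k * B j j.
Proof.
rewrite /qform -/(bform _ _ _) /polvec !bformDl !bformDr !bformZl !bformZr.
by rewrite !bform_delta; ring.
Qed.

Lemma conjc_iX k : conjc (('i : C) ^+ k) = (- 'i) ^+ k.
Proof. by rewrite -conjCi; exact: rmorphXn. Qed.

(** The identity behind [mx_integral]: entries are recovered from the diagonal values at the vectors
    [polvec]. *)
Lemma polarization B i j :
  B i j = 4%:R^-1 * \sum_(k < 4) conjc ('i ^+ k) * qform B (polvec R i j k).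
Proof.
under eq_bigr do rewrite qform_polvec conjc_iX.
by rewrite roots4_sum ?mulKf ?pnatr_eq0// -expr2 sqrCi.
Qed.

Lemma qform1 x : qform 1%:M x = (\sum_i (Re (x i 0) ^+ 2 + Im (x i 0) ^+ 2))%:C.
Proof.
rewrite /qform mulmx1 mxE rmorph_sum; apply: eq_bigr => i _.
rewrite !mxE; case: (x i 0) => a b; rewrite /= /GRing.mul/=.
by congr (_ +i* _); ring.
Qed.

Lemma qform1_gt0 x : x != 0 -> 0 < Re (qform 1%:M x).
Proof.
move=> /cV0Pn[i xi]; rewrite qform1/= (bigD1 i)//= ltr_pwDl//.
  rewrite lt_def paddr_eq0 ?sqr_ge0// addr_ge0 ?sqr_ge0// andbT.
  rewrite !sqrf_eq0; apply: contra xi; case: (x i 0) => a b /=.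
  by rewrite eq_complex.
by apply: sumr_ge0 => j _; rewrite addr_ge0 ?sqr_ge0.
Qed.

(** The form of [P] at [v] is the squared norm of [P v]. *)
Lemma psd_orth_proj (P : 'M[C]_n) : adjmx P = P -> P *m P = P -> psd_mx P.
Proof.
move=> aP PP v.
have -> : qform P v = qform 1%:M (P *m v).
  by rewrite /qform adjmxM aP mulmx1 -!mulmxA (mulmxA P P v) PP mulmxA.
by rewrite qform1/=; split=> //; apply: sumr_ge0 => j _; rewrite addr_ge0 ?sqr_ge0.
Qed.

(** For real [s] the value at [s x + y] is affine in [s] and nonnegative, so its slope, the cross
    term, vanishes. *)
Lemma psd_null B x y : psd_mx B -> Re (qform B x) = 0 ->
  Re (qform B (x + y)) = Re (qform B y).
Proof.
move=> pB x0; rewrite qformD !Re_add x0 add0r.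
set b := (X in _ + X = _); have [->|b0] := eqVneq b 0; first by rewrite addr0.
(* With a nonzero slope, this [s] gives the affine function the value -1. *)
pose s := - (Re (qform B y) + 1) / b.
have := (pB (s%:C *: x + y)).2.
rewrite qformD [qform B (_ *: _)](_ : _ = conjc s%:C * (s%:C * qform B x)).
  rewrite bformZl bformZr conjc_real -mulrDr Re_add [Re (_ + qform B y)]Re_add.
  rewrite !Re_scale Re_add x0 -/b !mulr0 add0r.
  by rewrite /s divfK//; lra.
by rewrite /qform -!/(bform _ _ _) bformZl bformZr.
Qed.

End SesquilinearForm.

(** * Matrix measures and their scalar compressions *)

Lemma cvg_sumr (R : realType) (I : Type) (s : seq I) (u : I -> nat -> R) (l : I -> R) :
  (forall i, u i @ \oo --> l i) ->
  (fun n => \sum_(i <- s) u i n) @ \oo --> \sum_(i <- s) l i.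
Proof.
move=> ul; elim: s => [|i s ih].
  by rewrite big_nil; under eq_fun do rewrite big_nil; exact: cvg_cst.
by rewrite big_cons; under eq_fun do rewrite big_cons; exact: cvgD.
Qed.

Section MatrixMeasure.
Local Open Scope complex_scope.
Variables (R : realType) (X : ptopologicalType).
Local Notation C := R[i].
Local Notation Re := (@complex.Re R).
Local Notation Im := (@complex.Im R).
Local Notation fmeas := (@finite_measure_on_Borel R X).

(** The real part of the form is a fixed real combination of the real and imaginary parts of the
    entries, whose countable additivity is given. *)
Lemma fmeas_qform d (nu : set X -> 'M[C]_d) v :
  pos_matrix_measure nu -> fmeas (fun A => Re (qform (nu A) v)).
Proof.
move=> [ms pp]; split=> [A mA|F mF tF]; first exact: (pp A mA v).2.
pose w i j := conjc (v i 0) * v j 0.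
have E (B : 'M[C]_d) : Re (qform B v) =
    \sum_i \sum_j (Re (w i j) * Re (B i j) - Im (w i j) * Im (B i j)).
  rewrite qformE Re_sum; apply: eq_bigr => i _; rewrite Re_sum.
  by apply: eq_bigr => j _; rewrite Re_mul.
have sumE n : \sum_(k < n) Re (qform (nu (F k)) v) =
    Re (qform (\sum_(k < n) nu (F k)) v).
  rewrite -Re_sum; congr Re.
  by rewrite /qform mulmx_sumr mulmx_suml summxE.
under eq_fun do rewrite sumE E; rewrite E.
apply: cvg_sumr => i; apply: cvg_sumr => j.
by have [hR hI] := ms F mF tF i j; apply: cvgB; apply: cvgZr.
Qed.

Hypothesis cX : compact [set: X].

(** [mx_integral] sees only the vectors [polvec]. Polarization expresses the form at any [v] as a
    combination of the forms at those vectors, and [Int_lin0] carries this relation to integrals. *)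
Lemma Int_qform0 d (nu : set X -> 'M[C]_d) (f : X -> R) v :
  continuous f -> pos_matrix_measure nu -> mx_integral nu f = 0 ->
  Int f (fun A => Re (qform (nu A) v)) = 0.
Proof.
move=> cf pnu I0.
pose w i j : C := conjc (v i 0) * v j 0 * 4%:R^-1.
pose T := ('I_d * 'I_d * 'I_4)%type.
(* [None] indexes the measure along [v], with coefficient -1, so that the expansion becomes a
   vanishing combination. *)
pose a (o : option T) : R := if o is Some (i, j, k) then
  Re (w i j * conjc ('i ^+ k)) else -1.
pose g (o : option T) A := if o is Some (i, j, k) then
  Re (qform (nu A) (polvec R i j k)) else Re (qform (nu A) v).
have hg o : fmeas (g o) by case: o => [[[i j] k]|]; exact: fmeas_qform.
have big3 (F : 'I_d -> 'I_d -> 'I_4 -> R) :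
    \sum_(p : T) F p.1.1 p.1.2 p.2 = \sum_i \sum_j \sum_k F i j k.
  rewrite (pair_bigA _ (fun i j => \sum_k F i j k)).
  by rewrite (pair_bigA _ (fun p k => F p.1 p.2 k)).
have aE (b : option T -> R) :
    \sum_(o <- None :: map Some (enum {: T})) a o * b o =
    - b None +
    \sum_i \sum_j \sum_(k < 4) Re (w i j * conjc ('i ^+ k)) * b (Some (i, j, k)).
  rewrite big_cons big_map big_enum mulN1r; congr (_ + _).
  rewrite -(big3 (fun i j (k : 'I_4) =>
    Re (w i j * conjc ('i ^+ k)) * b (Some (i, j, k)))).
  by apply: eq_bigr => -[[i j] k].
have := Int_lin0 cX cf (a := a) (s := None :: map Some (enum {: T})) hg.
rewrite aE => h; apply/eqP; rewrite -oppr_eq0 -[X in _ == X]h; last first.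
  move=> A mA; rewrite aE /= qformE Re_sum -sumrN -big_split big1// => i _ /=.
  rewrite Re_sum -sumrN -big_split big1// => j _ /=.
  rewrite (polarization (nu A) i j) mulrA mulr_sumr Re_sum.
  rewrite [X in _ + X](_ : _ = \sum_(k < 4) Re (w i j * (conjc ('i ^+ k) *
    qform (nu A) (polvec R i j k)))) ?addNr//.
  (* Positivity makes the form real, so the real part of the product factors. *)
  apply: eq_bigr => k _; rewrite mulrA [in RHS]Re_mul.
  by rewrite (pnu.2 A mA _).1 mulr0 subr0.
rewrite eq_sym -subr_eq0 opprK addrAC addNr add0r; apply/eqP.
apply: big1 => i _; apply: big1 => j _.
have /matrixP/(_ i j) := I0; rewrite !mxE.
move=> /(congr1 (fun z => Re (conjc (v i 0) * v j 0 * z))).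
rewrite mulr0 mulrA mulr_sumr Re_sum => h0; rewrite -[RHS]h0.
by apply: eq_bigr => k _; rewrite mulrA [RHS]Re_mul/= mulr0 subr0.
Qed.

Variables (m : nat) (phi : 'I_m -> X -> R).
Hypothesis cphi : forall r, continuous (phi r).

(** The mass along [x] is the squared norm of [x], hence the normalizing factor. *)
Lemma Cset_scalar d (nu : set X -> 'M[C]_d) x : Cset phi nu -> x != 0 ->
  scalar_Cset phi (fun A => (Re (qform 1%:M x))^-1 * Re (qform (nu A) x)).
Proof.
move=> [pnu nuT nuI] /qform1_gt0 x0.
have i0 : 0 <= (Re (qform 1%:M x))^-1 by rewrite invr_ge0 ltW.
have hx := fmeas_qform x pnu.
split=> [||r]; first exact: fmeasZ.
  by rewrite nuT mulVf// gt_eqF.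
by rewrite IntZ// Int_qform0 ?mulr0.
Qed.

(** Serves both for the given [mu] and, with [n = 1], to lift scalar competitors to 1 by 1 matrix
    measures. *)
Lemma Cset_sum d n (g : 'I_n -> set X -> R) (P : 'I_n -> 'M[C]_d)
    (mu : set X -> 'M[C]_d) :
  (forall k, scalar_Cset phi (g k)) -> (forall k, psd_mx (P k)) ->
  \sum_k P k = 1%:M ->
  (forall A, Borel A -> mu A = \sum_k (g k A)%:C *: P k) -> Cset phi mu.
Proof.
move=> Cg pP P1 muE.
have hg k : fmeas (g k) by have [] := Cg k.
have muR A i j : Borel A -> Re (mu A i j) = \sum_k Re (P k i j) * g k A.
  move=> mA; rewrite muE// summxE Re_sum; apply: eq_bigr => k _.
  by rewrite mxE Re_scale mulrC.
have muI A i j : Borel A -> Im (mu A i j) = \sum_k Im (P k i j) * g k A.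
  move=> mA; rewrite muE// summxE Im_sum; apply: eq_bigr => k _.
  by rewrite mxE Im_scale mulrC.
have muq A v : Borel A ->
    qform (mu A) v = (\sum_k Re (qform (P k) v) * g k A)%:C.
  move=> mA; rewrite muE// qform_lin rmorph_sum; apply: eq_bigr => k _.
  by rewrite [qform _ _]complex_of_Im0 ?(pP k v).1// -rmorphM mulrC.
have sg (F : nat -> set X) (c : 'I_n -> R) : (forall k, Borel (F k)) -> trivIset setT F ->
    (fun p => \sum_(l < p) \sum_k c k * g k (F l)) @ \oo -->
    \sum_k c k * g k (\bigcup_l F l).
  move=> mF tF; under eq_fun do rewrite exchange_big/=.
  apply: cvg_sumr => k; under eq_fun do rewrite -mulr_sumr.
  by apply: cvgZr; exact: (hg k).2.
split.
- split.
  + move=> F mF tF i j; have mUF : Borel (\bigcup_k F k).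
      exact: (@bigcupT_measurable _ (borelX X)).
    split; [rewrite muR//|rewrite muI//].
    * have -> : (fun p => Re ((\sum_(l < p) mu (F l)) i j)) =
          (fun p => \sum_(l < p) \sum_k Re (P k i j) * g k (F l)); last exact: sg.
        apply/funext => p; rewrite summxE Re_sum.
        by apply: eq_bigr => l _; rewrite muR.
    * have -> : (fun p => Im ((\sum_(l < p) mu (F l)) i j)) =
          (fun p => \sum_(l < p) \sum_k Im (P k i j) * g k (F l)); last exact: sg.
        apply/funext => p; rewrite summxE Im_sum.
        by apply: eq_bigr => l _; rewrite muI.
  + move=> A mA v; rewrite muq//; split=> //=; apply: sumr_ge0 => k _.
    by rewrite mulr_ge0 ?(pP k v).2// (hg k).1.
- rewrite muE; last exact: BorelT.
  by rewrite -P1; apply: eq_bigr => k _; have [_ -> _] := Cg k; rewrite scale1r.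
- move=> r; apply/matrixP => i j; rewrite !mxE big1 ?mulr0// => k _.
  rewrite (_ : fine _ = 0) ?mulr0//.
  rewrite -[LHS]/(Int (phi r) (fun A => Re (qform (mu A) (polvec R i j k)))).
  rewrite (@eq_Int _ _ _ _ (fun A =>
    \sum_l Re (qform (P l) (polvec R i j k)) * g l A)).
    rewrite Int_sum// => [|l]; last exact: (pP _ _).2.
    by rewrite big1// => l _; have [_ _ ->] := Cg l; rewrite mulr0.
  by move=> A mA; rewrite muq.
Qed.

Lemma extreme_Cset_scalar (la : set X -> 'M[C]_1) : extreme_Cset phi la ->
  scalar_extreme phi (fun A => Re (la A 0 0)) /\
  forall A, Borel A -> la A 0 0 = (Re (la A 0 0))%:C.
Proof.
move=> [Cla ela].
have q1 (B : 'M[C]_1) : qform B (const_mx 1) = B 0 0.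
  by rewrite qformE !big_ord1 !mxE conjc1 !mul1r.
have laE A : Borel A -> la A 0 0 = (Re (la A 0 0))%:C.
  move=> mA; apply: complex_of_Im0.
  by have [[_ /(_ A mA (const_mx 1))[+ _]] _ _] := Cla; rewrite q1.
split=> //; split.
  have /(Cset_scalar Cla) : (const_mx 1 : 'cV[C]_1) != 0.
    by apply/cV0Pn; exists 0; rewrite mxE oner_eq0.
  rewrite q1 mxE eqxx /= invr1; under eq_fun do rewrite mul1r q1; exact.
move=> g1 g2 t C1 C2 t01 lag A mA.
pose M (g : set X -> R) A : 'M[C]_1 := (g A)%:C%:M.
have CM g : scalar_Cset phi g -> Cset phi (M g).
  move=> Cg; apply: (@Cset_sum _ 1 (fun=> g) (fun=> 1%:M)) => // [k v||B mB].
  - by rewrite qform1/=; split=> //; apply: sumr_ge0 => j _; rewrite addr_ge0 ?sqr_ge0.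
  - by rewrite big_ord1.
  - by rewrite big_ord1 scalemx1.
have [] := ela _ _ t (CM _ C1) (CM _ C2) t01 _ A mA.
  move=> B mB; apply/matrixP => i j; rewrite !ord1 laE// lag// !mxE eqxx !mulr1n.
  by rewrite rmorphD !rmorphM.
by move=> <- _; rewrite /M mxE eqxx.
Qed.

End MatrixMeasure.

(** * Uniqueness of the decomposition, block by block *)

Section BlockDiagonal.
Local Open Scope complex_scope.
Variables (R : realType) (X : ptopologicalType) (N m : nat).
Local Notation C := R[i].
Local Notation Re := (@complex.Re R).
Variables (phi : 'I_m -> X -> R) (P : 'I_N -> 'M[C]_N).
Hypothesis cX : compact [set: X].
Hypothesis cphi : forall r, continuous (phi r).
Hypothesis PP : forall k, P k *m P k = P k.
Hypothesis Porth : forall k l, k != l -> P k *m P l = 0.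
Hypothesis P1 : \sum_k P k = 1%:M.
Variables (g : 'I_N -> set X -> R) (mu nu1 nu2 : set X -> 'M[C]_N) (t : R).
Hypothesis eg : forall k, scalar_extreme phi (g k).
Hypothesis muE : forall A, Borel A -> mu A = \sum_k (g k A)%:C *: P k.
Hypotheses (Cmu : Cset phi mu) (C1 : Cset phi nu1) (C2 : Cset phi nu2).
Hypothesis t01 : 0 < t < 1.
Hypothesis mu12 :
  forall A, Borel A -> mu A = t%:C *: nu1 A + (1 - t)%:C *: nu2 A.

Let qmu A k x : Borel A -> P k *m x = x ->
  qform (mu A) x = (g k A)%:C * qform 1%:M x.
Proof.
move=> mA Px; rewrite muE// qform_lin (bigD1 k)//= big1 ?addr0.
  by rewrite /qform -mulmxA Px mulmx1.
move=> l lk; rewrite /qform -mulmxA -Px (mulmxA (P l)) Porth//.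
by rewrite mul0mx mulmx0 mxE mulr0.
Qed.

(** For nonzero [x] the normalized compressions of [nu1] and [nu2] are admissible and average to
    [g k], so extremality applies. *)
Let diag A k x : Borel A -> P k *m x = x ->
  Re (qform (nu1 A) x) = Re (qform (mu A) x).
Proof.
move=> mA Px; have [->|x0] := eqVneq x 0; first by rewrite /qform !mulmx0 mxE.
have s0 := lt0r_neq0 (qform1_gt0 x0).
have avg B : Borel B -> g k B =
    t * ((Re (qform 1%:M x))^-1 * Re (qform (nu1 B) x)) +
    (1 - t) * ((Re (qform 1%:M x))^-1 * Re (qform (nu2 B) x)).
  move=> mB; have := congr1 Re (qmu mB Px).
  rewrite mu12// qform_comb Re_add !Re_scale => h.
  by apply: (mulIf s0); rewrite -h; field.
have S1 := Cset_scalar cX cphi C1 x0; have S2 := Cset_scalar cX cphi C2 x0.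
have := (eg k).2 _ _ t S1 S2 t01 avg A mA.
rewrite (qmu mA Px) Re_scale => <-.
by rewrite mulrAC mulVf// mul1r.
Qed.

(** As measures in [A], both sides have equal mass and moments. On sets null for [g k], [psd_null]
    removes [x] from both forms and [diag] in block [l] compares the rest, so
    [scalar_extreme_dominated] applies. *)
Let offdiag A k l x y : Borel A -> P k *m x = x -> P l *m y = y ->
  qform (nu1 A) (x + y) = qform (mu A) (x + y).
Proof.
have [[pmu psdmu] muT muI] := Cmu; have [[p1 psd1] nuT nuI] := C1.
move=> mA Px Py.
rewrite [LHS]complex_of_Im0 ?(psd1 A mA _).1// [RHS]complex_of_Im0 ?(psdmu A mA _).1//.
congr (_%:C); move: A mA.
apply: (scalar_extreme_dominated cX cphi (eg k)).
- exact: fmeas_qform.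
- exact: fmeas_qform.
- by rewrite muT nuT.
- by move=> r; rewrite !Int_qform0.
- move=> A mA gA0.
  have x0 : Re (qform (mu A) x) = 0 by rewrite (qmu mA Px) Re_scale gA0 mul0r.
  rewrite (psd_null _ (psdmu A mA))// (psd_null _ (psd1 A mA)) ?(diag mA Px)//.
  exact: diag mA Py.
Qed.

Let off0 A k l x y : Borel A -> P k *m x = x -> P l *m y = y ->
  bform (nu1 A - mu A) x y = 0.
Proof.
move=> mA Px Py; set D := nu1 A - mu A.
have qD z w : P k *m z = z -> P l *m w = w -> qform D (z + w) = 0.
  move=> Pz Pw; rewrite [LHS]bformB; apply/eqP; rewrite subr_eq0; apply/eqP.
  exact: (offdiag mA Pz Pw).
(* Zero lies in every range, so [qD] covers single vectors too. *)
have qx : qform D x = 0 by have := qD x 0 Px (mulmx0 _ _); rewrite addr0.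
have ql w : P l *m w = w -> qform D w = 0.
  by move=> Pw; have := qD 0 w (mulmx0 _ _) Pw; rewrite add0r.
have bs w : P l *m w = w -> bform D x w + bform D w x = 0.
  by move=> Pw; have := qD x w Px Pw; rewrite qformD qx (ql w Pw) !add0r.
have h1 := bs y Py.
(* Passing to ['i *: y] flips the relative sign of the two cross terms, so each vanishes
   separately. *)
have := bs ('i *: y); rewrite -scalemxAr Py => /(_ erefl).
rewrite bformZl bformZr -(addr0_eq h1) [conjc _]conjCi.
rewrite mulrN mulNr opprK -mulr2n -mulrnAr => /eqP.
by rewrite mulf_eq0 (negPf (neq0Ci _))/= mulrn_eq0/= => /eqP.
Qed.

(** Splitting the basis vectors along the ranges of the [P k] reduces each entry of the difference
    to the forms handled by [off0]. *)
Lemma block_measure_unique A : Borel A -> nu1 A = mu A.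
Proof.
move=> mA; apply/eqP; rewrite -subr_eq0; apply/eqP/matrixP => i j.
have PE (v : 'cV[C]_N) : v = \sum_k P k *m v by rewrite -mulmx_suml P1 mul1mx.
rewrite -bform_delta (PE (delta_mx i 0)) bform_suml mxE big1// => k _.
rewrite (PE (delta_mx j 0)) bform_sumr big1// => l _.
by apply: (@off0 A k l); rewrite // mulmxA PP.
Qed.

End BlockDiagonal.

Theorem theorem3p14 (R : realType) (X : ptopologicalType)
  (hcomp : compact [set: X]) (hhaus : hausdorff_space X)
  (N m : nat) (hN : (0 < N)%N)
  (phi : 'I_m -> X -> R) (hphi : forall r, continuous (phi r))
  (P : 'I_N -> 'M[R[i]]_N)
  (hP : forall k, rank1_orth_proj (P k))
  (hPorth : forall k l, k != l -> P k *m P l = 0)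
  (hPsum : \sum_(k < N) P k = 1%:M)
  (mus : 'I_N -> set X -> 'M[R[i]]_1)
  (hmus : forall k, extreme_Cset phi (mus k))
  (mu : set X -> 'M[R[i]]_N)
  (hmu : forall A, Borel A -> mu A = \sum_(k < N) (mus k A 0 0) *: P k) :
  extreme_Cset phi mu.
Proof.
pose g k A := complex.Re (mus k A 0 0).
have eg k : scalar_extreme phi (g k).
  exact: (extreme_Cset_scalar hcomp hphi (hmus k)).1.
have muE A : Borel A -> mu A = \sum_k (g k A)%:C%C *: P k.
  move=> mA; rewrite hmu//; apply: eq_bigr => k _; congr (_ *: _).
  exact: (extreme_Cset_scalar hcomp hphi (hmus k)).2.
have PP k : P k *m P k = P k by have [] := hP k.
have Cmu : Cset phi mu.
  apply: (Cset_sum hcomp hphi (g := g) (P := P)) => // k; first exact: (eg k).1.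
  by have [aP _ _] := hP k; exact: psd_orth_proj.
split=> // nu1 nu2 t C1 C2 t01 mu12 A mA; split.
  exact: (block_measure_unique hcomp hphi PP hPorth hPsum eg muE Cmu C1 C2 t01 mu12).
(* The second summand follows by exchanging [nu1] with [nu2] and [t] with [1 - t]. *)
apply: (block_measure_unique (t := 1 - t) hcomp hphi PP hPorth
  hPsum eg muE Cmu C2 C1) => //.
  by rewrite subr_gt0 ltrBlDr ltrDl andbC.
by move=> B mB; rewrite mu12// subKr addrC.
Qed.
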